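(* AMLFI1 is decidable: there is an effective procedure that, given any $\alpha\in\mathcal{L}_{AM}$, determines in finitely many steps whether $\alpha$ is satisfiable; if $\alpha$ is satisfiable it determines a model and state $s$ with $\vartheta_s(\alpha)\in\{1,\tfrac12\}$, and if $\alpha$ is not satisfiable it determines a model and state $s$ with $\vartheta_s(\alpha)=0$.
   Context: **Language.** $P$ is a countable set of propositional variables and $N$ a finite set of agents. The formulas of $\mathcal{L}_{AM}$ and the action models are defined by simultaneous recursion. Formulas: $\alpha ::= p \mid \neg\alpha \mid \bullet\alpha \mid (\alpha\land\alpha) \mid K_i\alpha \mid [U,e]\alpha$, with $p\in P$, $i\in N$, $U$ an action model and $e$ an action of $U$. An action model is $U=\langle E,\{\sim_i\}_{i\in N},\mathrm{pre}\rangle$ with $E$ a finite non-empty set of actions, each $\sim_i$ an equivalence relation on $E$, and $\mathrm{pre}:E\to\mathcal{L}_{AM}$ (preconditions). Formulas are thus finite objects. **Semantics.** Truth values $\{0,\tfrac12,1\}$, designated values $D=\{1,\tfrac12\}$. A Kripke model is $M=\langle S,\{\sim_i\}_{i\in N},\vartheta\rangle$ with $S$ a set of states, each $\sim_i$ an equivalence relation on $S$, and for each $s\in S$ a map $\vartheta_s:P\to\{0,\tfrac12,1\}$, extended to formulas by: $\vartheta_s(\neg\alpha)=1-\vartheta_s(\alpha)$; $\vartheta_s(\bullet\alpha)=1$ if $\vartheta_s(\alpha)=\tfrac12$ and $0$ otherwise; $\vartheta_s(\alpha\land\beta)=\min\{\vartheta_s(\alpha),\vartheta_s(\beta)\}$;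 $\vartheta_s(K_i\alpha)=\inf\{\vartheta_{t}(\alpha):s\sim_i t\}$ (with $\inf\emptyset=1$); $\vartheta_s([U,e]\alpha)=\vartheta'_{(s,e)}(\alpha)$ if $\vartheta_s(\mathrm{pre}(e))\in D$, and $1$ otherwise. Here $\vartheta'$ is the valuation of the updated model $M\otimes U=\langle S',\{\sim_i'\},\vartheta'\rangle$ with $S'=\{(t,f):t\in S,f\in E,\vartheta_t(\mathrm{pre}(f))\in D\}$, $(t,f)\sim'_i(u,g)$ iff $t\sim_i u$ and $f\sim_i g$, and $\vartheta'_{(t,f)}(p)=\vartheta_t(p)$ for $p\in P$. A formula $\alpha$ is satisfiable if $\vartheta_s(\alpha)\in D$ for some such model and some state $s$. *)

(* Defs.v *)
From mathcomp Require Import all_boot.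
From mathcomp Require Import boolp.
From Stdlib Require Import RelationClasses.

Set Implicit Arguments.
Unset Strict Implicit.
Unset Printing Implicit Defensive.

Inductive tv : Type := t0 | thalf | t1.

Definition tneg (v : tv) : tv :=
  match v with t0 => t1 | thalf => thalf | t1 => t0 end.

Definition tbullet (v : tv) : tv :=
  match v with thalf => t1 | _ => t0 end.

Definition tmin (v w : tv) : tv :=
  match v, w with
  | t0, _ | _, t0 => t0
  | thalf, _ | _, thalf => thalf
  | t1, t1 => t1
  end.

(* Infimum for the order 0 < 1/2 < 1; the empty set has infimum 1. *)
Definition tinf (A : tv -> Prop) : tv :=
  if `[< A t0 >] then t0 else if `[< A thalf >] then thalf else t1.

Definition designated (v : tv) : bool :=
  match v with t0 => false | _ => true end.

Record finframe (N : finType) : Type := FinFrame {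
  point :> finType;
  prel : N -> rel point;
  prel_equiv : forall i, equivalence_rel (prel i)
}.

(* [Upd pre e a] is [U,e]a for the action model U = <E, {~_i}, pre>; E is
   non-empty because of e. *)
Inductive formula (P : countType) (N : finType) : Type :=
| Var (p : P)
| Neg (a : formula P N)
| Bullet (a : formula P N)
| And (a b : formula P N)
| Know (i : N) (a : formula P N)
| Upd (E : finframe N) (pre : E -> formula P N) (e : E) (a : formula P N).

Record model (P : countType) (N : finType) : Type := Model {
  state :> Type;
  krel : N -> state -> state -> Prop;
  krel_equiv : forall i, Equivalence (krel i);
  val0 : state -> P -> tv
}.

Lemma prel_equivalence (N : finType) (F : finframe N) (i : N) :
  Equivalence (fun x y : F => prel i x y : Prop).
Proof.
have eqF := @prel_equiv N F i.
have Fr (x : F) : prel i x x by have [] := eqF x x x.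
split.
- exact: Fr.
- by move=> x y xy; have [_ /(_ xy)] := eqF x y x; rewrite Fr => <-.
- by move=> x y z xy yz; have [_ /(_ xy) ->] := eqF x y z.
Qed.

(* States of the updated model; [ok t f] stands for "the precondition of f
   is designated at t". *)
Definition upd_state (P : countType) (N : finType) (M : model P N)
    (E : finframe N) (ok : M -> E -> bool) : Type :=
  {x : M * E | ok x.1 x.2}.

Definition upd_rel (P : countType) (N : finType) (M : model P N)
    (E : finframe N) (ok : M -> E -> bool) (i : N) (x y : upd_state ok) : Prop :=
  krel i (sval x).1 (sval y).1 /\ prel i (sval x).2 (sval y).2.

Lemma upd_rel_equiv (P : countType) (N : finType) (M : model P N)
    (E : finframe N) (ok : M -> E -> bool) (i : N) :
  Equivalence (@upd_rel P N M E ok i).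
Proof.
have [Mr Ms Mt] := krel_equiv M i.
have [Er Es Et] := prel_equivalence E i.
split.
- by move=> x; split; [exact: Mr | exact: Er].
- by move=> x y [xy fg]; split; [exact: Ms | exact: Es].
- move=> x y z [xy fg] [yz gh]; split; [exact: Mt xy yz | exact: Et fg gh].
Qed.

Definition update (P : countType) (N : finType) (M : model P N)
    (E : finframe N) (ok : M -> E -> bool) : model P N :=
  Model (@upd_rel_equiv P N M E ok) (fun x p => val0 (sval x).1 p).

Fixpoint eval (P : countType) (N : finType) (a : formula P N)
    (M : model P N) (s : M) {struct a} : tv :=
  match a with
  | Var p => val0 s p
  | Neg b => tneg (eval b s)
  | Bullet b => tbullet (eval b s)
  | And b c => tmin (eval b s) (eval c s)
  | Know i b => tinf (fun v => exists2 t : M, krel i s t & eval b t = v)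
  | Upd E pre e b =>
      let ok (t : M) (f : E) := designated (eval (pre f) t) in
      (* [insub (s, e)] is the state (s, e) of the updated model if
         [ok s e], and [None] otherwise. *)
      if insub (s, e) : option (upd_state ok) is Some x
      then eval b (x : update ok) else t1
  end.

Definition satisfiable (P : countType) (N : finType) (a : formula P N) : Prop :=
  exists (M : model P N) (s : M), designated (eval a s).

(* The valuation at each state is a finite association list; variables not
   listed have value 0. *)
Record finmodel (P : countType) (N : finType) : Type := FinModel {
  fframe :> finframe N;
  ftab : fframe -> seq (P * tv)
}.

Definition lookup (P : countType) (l : seq (P * tv)) (p : P) : tv :=
  (nth (p, t0) l (find (fun x => x.1 == p) l)).2.

Definition kripke (P : countType) (N : finType) (M : finmodel P N) :
    model P N :=
  Model (@prel_equivalence N M) (fun s p => lookup (ftab s) p).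

(* First-order recursive programs over binary trees (pure LISP; the language
   F of N. D. Jones, "Computability and Complexity from a Programming
   Perspective"), a Turing-complete model of computation.  A program is a
   list of bodies of mutually recursive one-argument functions, the first of
   which is the main one; in a body, [EArg] is the argument and [ECall f e]
   calls the function number f. *)
Inductive data : Type := Nil | Cons (x y : data).

Definition hd (d : data) : data := if d is Cons x _ then x else Nil.
Definition tl (d : data) : data := if d is Cons _ y then y else Nil.

Inductive expr : Type :=
| EArg
| ENil
| ECons (e1 e2 : expr)
| EHd (e : expr)
| ETl (e : expr)
| EIf (e e1 e2 : expr)
| ECall (f : nat) (e : expr).

Definition program : Type := seq expr.

(* [evals pr x e v]: in program [pr], the expression [e] terminates with
   value [v] when the argument of the enclosing function is [x]. *)
Inductive evals (pr : program) (x : data) : expr -> data -> Prop :=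
| ev_arg : evals pr x EArg x
| ev_nil : evals pr x ENil Nil
| ev_cons e1 e2 v1 v2 :
    evals pr x e1 v1 -> evals pr x e2 v2 ->
    evals pr x (ECons e1 e2) (Cons v1 v2)
| ev_hd e v : evals pr x e v -> evals pr x (EHd e) (hd v)
| ev_tl e v : evals pr x e v -> evals pr x (ETl e) (tl v)
| ev_if_true e e1 e2 y z v :
    evals pr x e (Cons y z) -> evals pr x e1 v -> evals pr x (EIf e e1 e2) v
| ev_if_false e e1 e2 v :
    evals pr x e Nil -> evals pr x e2 v -> evals pr x (EIf e e1 e2) v
| ev_call f e y body v :
    evals pr x e y -> onth pr f = Some body -> evals pr y body v ->
    evals pr x (ECall f e) v.

(* [pr] halts on input [x] with output [y]; since evaluation is
   deterministic, the output is unique. *)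
Definition run (pr : program) (x y : data) : Prop :=
  evals pr x (ECall 0 EArg) y.

Definition enc_nat (n : nat) : data := iter n (Cons Nil) Nil.
Definition enc_seq (s : seq data) : data := foldr Cons Nil s.
Definition enc_bool (b : bool) : data := enc_nat b.
Definition enc_fin (T : finType) (x : T) : data := enc_nat (enum_rank x).

Definition enc_tv (v : tv) : data :=
  enc_nat (match v with t0 => 0 | thalf => 1 | t1 => 2 end).

Definition enc_frame (N : finType) (F : finframe N) : data :=
  enc_seq [seq enc_seq [seq enc_seq [seq enc_bool (prel i x y)
                                    | y <- enum F]
                       | x <- enum F]
          | i <- enum N].

Fixpoint enc_formula (P : countType) (N : finType) (a : formula P N) : data :=
  match a with
  | Var p => enc_seq [:: enc_nat 0; enc_nat (pickle p)]
  | Neg b => enc_seq [:: enc_nat 1; enc_formula b]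
  | Bullet b => enc_seq [:: enc_nat 2; enc_formula b]
  | And b c => enc_seq [:: enc_nat 3; enc_formula b; enc_formula c]
  | Know i b => enc_seq [:: enc_nat 4; enc_fin i; enc_formula b]
  | Upd E pre e b =>
      enc_seq [:: enc_nat 5; enc_frame E;
                  enc_seq [seq enc_formula (pre f) | f <- enum E];
                  enc_fin e; enc_formula b]
  end.

Definition enc_model (P : countType) (N : finType) (M : finmodel P N) : data :=
  Cons (enc_frame M)
       (enc_seq [seq enc_seq [seq Cons (enc_nat (pickle x.1)) (enc_tv x.2)
                             | x <- ftab s]
                | s <- enum M]).

Definition enc_answer (P : countType) (N : finType) (b : bool)
    (M : finmodel P N) (s : M) : data :=
  enc_seq [:: enc_bool b; enc_model M; enc_fin s].

(* Main.v *)
(* The value of a formula at a state is given by two static, two-valued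
   formulas, "is designated" and "has value 1"; updates are pushed inwards
   through K_i, where they become conjunctions over the related actions, and
   disappear at the variables.  A type is a set of variable atoms and
   K-subformulas of the resulting formula.  The types realised in a model form
   a coherent set (x contains K_i a iff a holds at all types of the set with the
   same K_i-formulas as x), and conversely a coherent set of types is itself
   a model in which every type satisfies exactly what it prescribes.  So it
   suffices to search the finitely many sets of types.

   On the machine side, the functions on trees that some program computes are
   closed under composition and under one recursion scheme on trees with
   a varying parameter; every function above is obtained from these. *)

From HB Require Import structures.
Require Import Defs.
From mathcomp Require Import all_boot.
From mathcomp Require Import boolp.
(* Again, since mathcomp's abbreviations hide the constructors of [data]. *)
Require Import Defs.

Set Implicit Arguments.
Unset Strict Implicit.
Unset Printing Implicit Defensive.

(** * Computable functions on trees *)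

(** Relocation of a function body that is to stand behind [k] other functions. *)
Fixpoint shift (k : nat) (e : expr) : expr :=
  match e with
  | EArg => EArg
  | ENil => ENil
  | ECons e1 e2 => ECons (shift k e1) (shift k e2)
  | EHd e => EHd (shift k e)
  | ETl e => ETl (shift k e)
  | EIf e e1 e2 => EIf (shift k e) (shift k e1) (shift k e2)
  | ECall f e => ECall (k + f) (shift k e)
  end.

Lemma evals_shift (pre pr post : program) (x : data) (e : expr) (v : data) :
  evals pr x e v ->
  evals (pre ++ map (shift (size pre)) pr ++ post) x (shift (size pre) e) v.
Proof.
elim=> {x e v} /=; try by move=> *; econstructor; eauto.
move=> x f e y body v _ IHe pr_f _ IHb; apply: ev_call IHe _ IHb.
have fS : f < size pr by rewrite -onthTE pr_f.
by rewrite onth_cat ltnNge leq_addr /= addKn onth_cat size_map fS onth_map pr_f.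
Qed.

Definition dcomp (f : data -> data) : Prop :=
  exists pr : program, forall x, run pr x (f x).

Lemma evals_call (pr : program) f x e y v :
  evals pr y (ECall f EArg) v -> evals pr x e y -> evals pr x (ECall f e) v.
Proof.
move=> H ey; inversion H as [| | | | | | |f' e' y' b v' ye pr_f bv]; subst.
by inversion ye; subst; apply: ev_call ey pr_f bv.
Qed.

(** The main body [m] is quantified after the indices [i] and [j], so that it may call the two
    linked functions, and itself as function 0. *)
Lemma link (f g : data -> data) : dcomp f -> dcomp g ->
  exists (rest : program) (i j : nat), forall m x e y,
    evals (m :: rest) x e y ->
    evals (m :: rest) x (ECall i e) (f y) /\
    evals (m :: rest) x (ECall j e) (g y).
Proof.
move=> [p hp] [q hq].
exists (map (shift 1) p ++ map (shift (1 + size p)) q), 1, (1 + size p).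
move=> m x e y ey; split; apply: evals_call ey.
  exact: (@evals_shift [:: m] p _ y (ECall 0 EArg) _ (hp y)).
have := @evals_shift (m :: map (shift 1) p) q [::] y (ECall 0 EArg) _ (hq y).
by rewrite /= size_map cats0 addn0.
Qed.

Lemma run_main (m : expr) (rest : program) (x v : data) :
  evals (m :: rest) x m v -> run (m :: rest) x v.
Proof. by move=> H; apply: ev_call H => //; constructor. Qed.

Lemma dcomp_body (e : expr) f : (forall pr x, evals pr x e (f x)) -> dcomp f.
Proof.
by move=> H; exists [:: e] => x; apply: run_main.
Qed.

Lemma dcomp_id : dcomp id.
Proof. by apply: (@dcomp_body EArg) => *; constructor. Qed.

Lemma dcomp_const c : dcomp (fun _ => c).
Proof.
pose fix q c := match c with Nil => ENil | Cons a b => ECons (q a) (q b) end.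
apply: (@dcomp_body (q c)) => pr x.
by elim: c => [|a IHa b IHb] /=; constructor.
Qed.

Lemma dcomp_comp f g : dcomp f -> dcomp g -> dcomp (fun x => f (g x)).
Proof.
move=> hf hg; have [rest [i [j L]]] := link hf hg.
exists (ECall i (ECall j EArg) :: rest) => x; apply: run_main.
by apply: (proj1 (L _ _ _ _ _)); apply: (proj2 (L _ _ _ _ _)); constructor.
Qed.

Lemma dcomp_cons f g : dcomp f -> dcomp g -> dcomp (fun x => Cons (f x) (g x)).
Proof.
move=> hf hg; have [rest [i [j L]]] := link hf hg.
exists (ECons (ECall i EArg) (ECall j EArg) :: rest) => x; apply: run_main.
by constructor; [apply: (proj1 (L _ _ _ _ _)) | apply: (proj2 (L _ _ _ _ _))];
  constructor.
Qed.

Lemma dcomp_hd f : dcomp f -> dcomp (fun x => hd (f x)).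
Proof.
by apply: dcomp_comp; apply: (@dcomp_body (EHd EArg)) => *; do 2 constructor.
Qed.

Lemma dcomp_tl f : dcomp f -> dcomp (fun x => tl (f x)).
Proof.
by apply: dcomp_comp; apply: (@dcomp_body (ETl EArg)) => *; do 2 constructor.
Qed.

Lemma dcomp_if c f g : dcomp c -> dcomp f -> dcomp g ->
  dcomp (fun x => if c x is Cons _ _ then f x else g x).
Proof.
move=> hc hf hg.
(* [link] joins only two programs, so the three values are first packed into one tree. Both branches
   get evaluated, which is harmless for total functions. *)
pose sel z := if hd z is Cons _ _ then hd (tl z) else tl (tl z).
apply: (@dcomp_comp sel (fun x => Cons (c x) (Cons (f x) (g x)))); last first.
  by do 2 (apply: dcomp_cons => //).
apply: (@dcomp_body (EIf (EHd EArg) (EHd (ETl EArg)) (ETl (ETl EArg)))) => pr x.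
have ex : evals pr x (EHd EArg) (hd x) by do 2 constructor.
rewrite /sel; case E: (hd x) => [|y z]; rewrite E in ex.
  by apply: ev_if_false ex _; do 3 constructor.
by apply: ev_if_true ex _; do 3 constructor.
Qed.

(** From the parameter and the tree, [k] computes a pair of new parameters, one for each half. At a
    node [f] sees the parameter, the tree and both results, at a leaf only [Cons p Nil], so [tl] of
    its argument tells the cases apart. *)
Fixpoint drec (f k : data -> data) (p d : data) : data :=
  if d is Cons x y then
    let q := k (Cons p d) in
    f (Cons p (Cons d (Cons (drec f k (hd q) x) (drec f k (tl q) y))))
  else f (Cons p Nil).

Lemma dcomp_drec f k : dcomp f -> dcomp k ->
  dcomp (fun z => drec f k (hd z) (tl z)).
Proof.
move=> hf hk; have [rest [i [j L]]] := link hf hk.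
pose K := ECall j EArg.
pose m := EIf (ETl EArg)
  (ECall i (ECons (EHd EArg) (ECons (ETl EArg)
     (ECons (ECall 0 (ECons (EHd K) (EHd (ETl EArg))))
            (ECall 0 (ECons (ETl K) (ETl (ETl EArg))))))))
  (ECall i (ECons (EHd EArg) ENil)).
exists (m :: rest) => z; apply: run_main.
have argP u : evals (m :: rest) u EArg u by constructor.
have hdP e u v : evals (m :: rest) u e v -> evals (m :: rest) u (EHd e) (hd v).
  by constructor.
have tlP e u v : evals (m :: rest) u e v -> evals (m :: rest) u (ETl e) (tl v).
  by constructor.
have Kq p d : evals (m :: rest) (Cons p d) K (k (Cons p d)).
  by have [] := L m (Cons p d) _ _ (argP _).
have ifP e1 e2 u v :
    evals (m :: rest) u (if tl u is Cons _ _ then e1 else e2) v ->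
    evals (m :: rest) u (EIf (ETl EArg) e1 e2) v.
  have := tlP _ _ _ (argP u); case: (tl u) => [|a b] uE uv.
    exact: ev_if_false uE uv.
  exact: ev_if_true uE uv.
have main p d : evals (m :: rest) (Cons p d) m (drec f k p d).
  elim: d p => [|x IHx y IHy] p /=.
    apply: ifP => /=.
    apply: (proj1 (L _ _ _ _ _)).
    by constructor; [exact: hdP (argP _) | constructor].
  apply: ifP => /=.
  apply: (proj1 (L _ _ _ _ _)).
  constructor; first exact: hdP (argP _).
  constructor; first exact: tlP (argP _).
  constructor; (apply: ev_call;
    [constructor | exact: erefl | by [apply: IHx | apply: IHy]]).
  - exact: hdP (Kq _ _).
  - exact: hdP (tlP _ _ _ (argP _)).
  - exact: tlP (Kq _ _).
  - exact: tlP (tlP _ _ _ (argP _)).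
(* The argument [Nil] behaves like [Cons Nil Nil], since [hd] and [tl] send [Nil] to [Nil]. *)
case: z => [|p d]; last exact: main.
rewrite /=; apply: ifP => /=.
apply: (proj1 (L _ _ _ _ _)).
by constructor; [exact: hdP (argP _) | constructor].
Qed.

(** * Computable functions between encoded types *)

Class Enc (A : Type) : Type := enc : A -> data.
#[export] Instance enc_data_inst : Enc data := id.
#[export] Instance enc_nat_inst : Enc nat := enc_nat.
#[export] Instance enc_bool_inst : Enc bool := enc_bool.
#[export] Instance enc_tv_inst : Enc tv := enc_tv.
#[export] Instance enc_prod_inst A B {EA : Enc A} {EB : Enc B} : Enc (A * B) :=
  fun x => Cons (enc x.1) (enc x.2).
#[export] Instance enc_seq_inst A {EA : Enc A} : Enc (seq A) :=
  fun s => enc_seq (map enc s).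

(** Only the values of [g] on codes are prescribed. Injectivity of codes is a separate hypothesis of
    the lemmas that compare elements. *)
Definition computable {A B} {EA : Enc A} {EB : Enc B} (f : A -> B) : Prop :=
  exists2 g, dcomp g & forall a, g (enc a) = enc (f a).

Lemma enc_cons A (EA : Enc A) (a : A) (s : seq A) :
  enc (a :: s) = Cons (enc a) (enc s).
Proof. by []. Qed.

Section Closure.
Context {G A B C : Type} {EG : Enc G} {EA : Enc A} {EB : Enc B} {EC : Enc C}.

Lemma computable_ext (f g : A -> B) : f =1 g -> computable f -> computable g.
Proof. by move=> fg [h hc hE]; exists h => // a; rewrite hE fg. Qed.

Lemma computable_id : computable (fun x : A => x).
Proof. by exists id; first exact: dcomp_id. Qed.

Lemma computable_const (c : B) : computable (fun _ : A => c).
Proof. by exists (fun _ => enc c); first exact: dcomp_const. Qed.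

Lemma computable_comp (f : B -> C) (g : A -> B) :
  computable f -> computable g -> computable (fun x => f (g x)).
Proof.
move=> [f' fc fE] [g' gc gE]; exists (fun x => f' (g' x)).
  exact: dcomp_comp.
by move=> a; rewrite gE fE.
Qed.

Lemma computable_pair (f : G -> A) (g : G -> B) :
  computable f -> computable g -> computable (fun x => (f x, g x)).
Proof.
move=> [f' fc fE] [g' gc gE]; exists (fun x => Cons (f' x) (g' x)).
  exact: dcomp_cons.
by move=> a; rewrite gE fE.
Qed.

Lemma computable_fst (f : G -> A * B) :
  computable f -> computable (fun x => (f x).1).
Proof.
move=> [f' fc fE]; exists (fun x => hd (f' x)); first exact: dcomp_hd.
by move=> a; rewrite fE.
Qed.

Lemma computable_snd (f : G -> A * B) :
  computable f -> computable (fun x => (f x).2).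
Proof.
move=> [f' fc fE]; exists (fun x => tl (f' x)); first exact: dcomp_tl.
by move=> a; rewrite fE.
Qed.

Lemma computable_if (c : G -> bool) (f g : G -> A) :
  computable c -> computable f -> computable g ->
  computable (fun x => if c x then f x else g x).
Proof.
move=> [c' cc cE] [f' fc fE] [g' gc gE].
exists (fun x => if c' x is Cons _ _ then f' x else g' x).
  exact: dcomp_if.
by move=> a; rewrite cE fE gE; case: (c a).
Qed.

Lemma computable_cons (f : G -> A) (g : G -> seq A) :
  computable f -> computable g -> computable (fun x => f x :: g x).
Proof.
move=> [f' fc fE] [g' gc gE]; exists (fun x => Cons (f' x) (g' x)).
  exact: dcomp_cons.
by move=> a; rewrite gE fE.
Qed.

Lemma computable_behead (f : G -> seq A) :
  computable f -> computable (fun x => behead (f x)).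
Proof.
move=> [f' fc fE]; exists (fun x => tl (f' x)); first exact: dcomp_tl.
by move=> a; rewrite fE; case: (f a).
Qed.

Lemma computable_head (f : G -> A) (g : G -> seq A) :
  computable f -> computable g -> computable (fun x => head (f x) (g x)).
Proof.
move=> [f' fc fE] [g' gc gE].
exists (fun x => if g' x is Cons _ _ then hd (g' x) else f' x).
  by apply: dcomp_if => //; apply: dcomp_hd.
by move=> a; rewrite gE fE; case: (g a).
Qed.

Lemma computable_nilp (f : G -> seq A) :
  computable f -> computable (fun x => nilp (f x)).
Proof.
move=> [f' fc fE].
exists (fun x => if f' x is Cons _ _ then enc false else enc true).
  by apply: dcomp_if => //; apply: dcomp_const.
by move=> a; rewrite fE; case: (f a).
Qed.

Lemma computable_foldr (F : G -> A -> B -> B) (Z : G -> B) (l : G -> seq A) :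
  computable (fun p : G * A * B => F p.1.1 p.1.2 p.2) ->
  computable Z -> computable l ->
  computable (fun x => foldr (F x) (Z x) (l x)).
Proof.
move=> [F' Fc FE] [Z' Zc ZE] [l' lc lE].
(* The argument [x] travels down unchanged as the parameter. Of the two results at a node, the one
   for the tail is the fold so far; the one for the element is discarded. *)
pose f z := if tl z is Cons _ _ then
    F' (Cons (Cons (hd z) (hd (hd (tl z)))) (tl (tl (tl z))))
  else Z' (hd z).
pose k z := Cons (hd z) (hd z).
have fc : dcomp f.
  apply: dcomp_if; first by apply: dcomp_tl dcomp_id.
    apply: dcomp_comp => //.
    by repeat first [exact: dcomp_id | apply: dcomp_cons | apply: dcomp_hd
                    | apply: dcomp_tl].
  by apply: dcomp_comp => //; apply: dcomp_hd dcomp_id.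
have kc : dcomp k by apply: dcomp_cons; apply: dcomp_hd dcomp_id.
exists (fun x => drec f k x (l' x)).
  apply: (dcomp_comp (dcomp_drec fc kc) (g := fun x => Cons x (l' x))).
  by apply: dcomp_cons => //; apply: dcomp_id.
move=> x; rewrite lE; elim: (l x) => [|a s IHs] /=; first by rewrite /f /= ZE.
by rewrite /f /= IHs -(FE (x, a, _)).
Qed.

End Closure.


Lemma computable_iter {G A} {EG : Enc G} {EA : Enc A}
    (F : G -> A -> A) (n : G -> nat) (Z : G -> A) :
  computable n -> computable (fun p : G * A => F p.1 p.2) -> computable Z ->
  computable (fun x => iter (n x) (F x) (Z x)).
Proof.
move=> [n' nc nE] [F' Fc FE] Zc.
apply: (computable_ext
  (f := fun x => foldr (fun _ : data => F x) (Z x) (nseq (n x) Nil))).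
  by move=> x; elim: (n x) => //= k ->.
apply: (computable_foldr (F := fun x (_ : data) => F x)) => //.
  exists (fun z => F' (Cons (hd (hd z)) (tl z))).
    by apply: dcomp_comp => //; apply: dcomp_cons; repeat first
      [exact: dcomp_id | apply: dcomp_hd | apply: dcomp_tl].
  by move=> [[x d] a]; rewrite -(FE (x, a)).
(* A number is coded in unary, by the same tree as a list of that many [Nil]. *)
exists n' => // x; rewrite nE; elim: (n x) => // k IHk.
exact: (congr1 (Cons Nil) IHk).
Qed.

Section Lists.
Context {G A B : Type} {EG : Enc G} {EA : Enc A} {EB : Enc B}.

Lemma computable_cat (f g : G -> seq A) :
  computable f -> computable g -> computable (fun x => f x ++ g x).
Proof.
move=> fc gc.
apply: (computable_ext (f := fun x => foldr (fun a s => a :: s) (g x) (f x))).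
  by move=> x; elim: (f x) => //= a s ->.
apply: (computable_foldr (F := fun x => cons)) => //.
apply: computable_cons; last exact: computable_snd computable_id.
exact: computable_snd (computable_fst computable_id).
Qed.

Lemma computable_map (F : G -> A -> B) (l : G -> seq A) :
  computable (fun p : G * A => F p.1 p.2) -> computable l ->
  computable (fun x => map (F x) (l x)).
Proof.
move=> Fc lc.
apply: (computable_foldr (F := fun x a s => F x a :: s)) => //; last first.
  exact: computable_const.
apply: computable_cons; last exact: computable_snd computable_id.
exact: computable_comp Fc (computable_fst computable_id).
Qed.

Lemma computable_filter (F : G -> A -> bool) (l : G -> seq A) :
  computable (fun p : G * A => F p.1 p.2) -> computable l ->
  computable (fun x => filter (F x) (l x)).
Proof.
move=> Fc lc.
apply: (computable_foldr (F := fun x a s => if F x a then a :: s else s)) => //;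
  last exact: computable_const.
apply: computable_if; last exact: computable_snd computable_id.
  exact: computable_comp Fc (computable_fst computable_id).
apply: computable_cons; last exact: computable_snd computable_id.
exact: computable_snd (computable_fst computable_id).
Qed.

Lemma computable_all (F : G -> A -> bool) (l : G -> seq A) :
  computable (fun p : G * A => F p.1 p.2) -> computable l ->
  computable (fun x => all (F x) (l x)).
Proof.
move=> Fc lc.
apply: (computable_foldr (F := fun x a s => if F x a then s else false)) => //;
  last exact: computable_const.
apply: computable_if; [|exact: computable_snd computable_id
                       |exact: computable_const].
exact: computable_comp Fc (computable_fst computable_id).
Qed.

Lemma computable_has (F : G -> A -> bool) (l : G -> seq A) :
  computable (fun p : G * A => F p.1 p.2) -> computable l ->
  computable (fun x => has (F x) (l x)).
Proof.
move=> Fc lc.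
apply: (computable_foldr (F := fun x a s => if F x a then true else s)) => //;
  last exact: computable_const.
apply: computable_if; [|exact: computable_const
                       |exact: computable_snd computable_id].
exact: computable_comp Fc (computable_fst computable_id).
Qed.

Lemma computable_find (F : G -> A -> bool) (l : G -> seq A) :
  computable (fun p : G * A => F p.1 p.2) -> computable l ->
  computable (fun x => find (F x) (l x)).
Proof.
move=> Fc lc.
apply: (computable_foldr (F := fun x a n => if F x a then 0 else n.+1)) => //;
  last exact: computable_const.
apply: computable_if.
- exact: computable_comp Fc (computable_fst computable_id).
- exact: computable_const.
exists (fun x => Cons Nil (tl x)) => //.
by apply: dcomp_cons; [apply: dcomp_const | apply: dcomp_tl; apply: dcomp_id].
Qed.

Lemma computable_nth (d : G -> A) (l : G -> seq A) (n : G -> nat) :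
  computable d -> computable l -> computable n ->
  computable (fun x => nth (d x) (l x) (n x)).
Proof.
move=> dc lc nc.
apply: (computable_ext (f := fun x => head (d x) (iter (n x) behead (l x)))).
  move=> x; elim: (n x) (l x) => [|k IHk] [|a s] //=;
    rewrite -iterS iterSr IHk //.
  by rewrite nth_nil.
apply: computable_head => //.
apply: (computable_iter (F := fun _ => behead)) => //.
exact: computable_behead (computable_snd computable_id).
Qed.

(** The recursion runs along the first list with the second as parameter; on the way into the right
    half [k] drops the head of the parameter. *)
Lemma computable_zip (f : G -> seq A) (g : G -> seq B) :
  computable f -> computable g -> computable (fun x => zip (f x) (g x)).
Proof.
move=> [f' fc fE] [g' gc gE].
pose F z := if tl z is Cons _ _ then if hd z is Cons _ _ then
    Cons (Cons (hd (hd (tl z))) (hd (hd z))) (tl (tl (tl z))) else Nil else Nil.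
pose k z := Cons (hd z) (tl (hd z)).
have Fc : dcomp F.
  by repeat first [exact: dcomp_id | exact: dcomp_const | apply: dcomp_if
                  | apply: dcomp_cons | apply: dcomp_hd | apply: dcomp_tl].
have kc : dcomp k.
  by repeat first [exact: dcomp_id | apply: dcomp_cons | apply: dcomp_hd
                  | apply: dcomp_tl].
exists (fun x => drec F k (g' x) (f' x)).
  apply: (dcomp_comp (dcomp_drec Fc kc) (g := fun x => Cons (g' x) (f' x))).
  exact: dcomp_cons.
move=> x; rewrite fE gE; elim: (f x) (g x) => [|a s IHs] [|b t] //=.
by rewrite enc_cons /F /k /= IHs.
Qed.
End Lists.

Section Booleans.
Context {G : Type} {EG : Enc G}.

Lemma computable_and (f g : G -> bool) :
  computable f -> computable g -> computable (fun x => f x && g x).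
Proof.
move=> fc gc; apply: (computable_if (g := xpred0)) => //.
exact: computable_const.
Qed.

Lemma computable_not (f : G -> bool) :
  computable f -> computable (fun x => ~~ f x).
Proof.
move=> fc; apply: (computable_if (f := xpred0) (g := xpredT)) => //;
  exact: computable_const.
Qed.

Lemma computable_imp (f g : G -> bool) :
  computable f -> computable g -> computable (fun x => f x ==> g x).
Proof.
move=> fc gc; apply: (computable_if (g := xpredT)) => //.
exact: computable_const.
Qed.

(** Two trees are compared by recursion on the second with the first as parameter: taking [hd] for
    [k] sends the halves of the parameter to the halves of the tree. Injectivity of [enc] carries
    the result back to [A]. *)
Lemma computable_eq (A : eqType) {EA : Enc A} (f g : G -> A) :
  injective (enc : A -> data) ->
  computable f -> computable g -> computable (fun x => f x == g x).
Proof.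
move=> enc_inj [f' fc fE] [g' gc gE].
pose F z := if tl z is Cons _ _ then
    if hd z is Cons _ _ then
      if hd (tl (tl z)) is Cons _ _ then tl (tl (tl z)) else Nil
    else Nil
  else if hd z is Cons _ _ then Nil else Cons Nil Nil.
have Fc : dcomp F.
  by repeat first [exact: dcomp_id | exact: dcomp_const | apply: dcomp_if
                  | apply: dcomp_cons | apply: dcomp_hd | apply: dcomp_tl].
have hc : dcomp hd by apply: dcomp_hd dcomp_id.
exists (fun x => drec F hd (f' x) (g' x)).
  apply: (dcomp_comp (dcomp_drec Fc hc) (g := fun x => Cons (f' x) (g' x))).
  exact: dcomp_cons.
move=> x; rewrite fE gE.
have E d p : drec F hd p d = enc `[< p = d >].
  elim: d p => [|a IHa b IHb] [|c e] /=.
  - by rewrite asboolT.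
  - by rewrite asboolF.
  - by rewrite /F /= asboolF.
  - rewrite /F /= IHa IHb; case: (asboolP (c = a)) => [->|ca].
      by congr enc; apply: asbool_equiv_eq; split=> [->|[]].
    by rewrite [`[< Cons c e = _ >]]asboolF // => -[].
rewrite E; congr enc; apply/asboolP/eqP => [/enc_inj //|-> //].
Qed.

End Booleans.

Lemma computable_mem {G} {EG : Enc G} (A : eqType) {EA : Enc A} (f : G -> A)
    (l : G -> seq A) :
  injective (enc : A -> data) ->
  computable f -> computable l -> computable (fun x => f x \in l x).
Proof.
move=> enc_inj fc lc.
apply: (computable_ext (f := fun x => has (fun y => f x == y) (l x))).
  by move=> x; rewrite -has_pred1; apply: eq_has => y /=; rewrite eq_sym.
apply: (computable_has (F := fun x y => f x == y)) => //.
apply: (computable_eq (f := fun p => f p.1)) => //.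
  exact: computable_comp fc (computable_fst computable_id).
exact: computable_snd computable_id.
Qed.

(** * Translation into static two-valued formulas *)

(* [BX p true] says that p has value 1, [BX p false] that it has value 1/2. *)
Inductive bform (P : countType) (N : finType) : Type :=
| BX (p : P) (c : bool)
| BNand (a b : bform P N)
| BK (i : N) (a : bform P N).
Arguments BX {P N}.

HB.instance Definition _ (P : countType) (N : finType) :=
  gen_eqMixin (bform P N).


Definition tv_is (c : bool) (v : tv) : bool :=
  match v with t0 => false | thalf => ~~ c | t1 => c end.

Section Translation.
Context {P : countType} {N : finType}.
Implicit Types (a b : bform P N) (M : model P N).

Fixpoint bev M a (s : M) : bool :=
  match a with
  | BX p c => tv_is c (val0 s p)
  | BNand a b => ~~ (bev a s && bev b s)
  | BK i a => `[< forall t, krel i s t -> bev a t >]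
  end.

Definition BNot a := BNand a a.
Definition BAnd a b := BNot (BNand a b).
Definition BImp a b := BNand a (BNot b).
Definition BOr a b := BNand (BNot a) (BNot b).

Lemma bev_know M i a (s : M) :
  bev (BK i a) s = `[< forall t, krel i s t -> bev a t >].
Proof. by []. Qed.

Lemma bev_not M a (s : M) : bev (BNot a) s = ~~ bev a s.
Proof. by rewrite /= andbb. Qed.

Lemma bev_and M a b (s : M) : bev (BAnd a b) s = bev a s && bev b s.
Proof. by rewrite bev_not /= negbK. Qed.

Lemma bev_imp M a b (s : M) : bev (BImp a b) s = (bev a s ==> bev b s).
Proof. by rewrite /= andbb negb_and negbK implybE. Qed.

(** [BImp a a] is a tautology standing for the empty conjunction, as the syntax has no constant for
    truth. *)
Definition guarded_conj a (s : seq (bool * bform P N)) : bform P N :=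
  foldr (fun q c => if q.1 then BAnd q.2 c else c) (BImp a a) s.

Lemma bev_guarded_conj M a s (t : M) :
  bev (guarded_conj a s) t = all (fun q => q.1 ==> bev q.2 t) s.
Proof.
elim: s => [|[[] c] s IHs]; first by rewrite bev_imp implybb.
  by rewrite [LHS]bev_and IHs.
exact: IHs.
Qed.

Definition frame_rows (E : finframe N) : seq (seq (seq bool)) :=
  [seq [seq [seq prel i x y | y <- enum E] | x <- enum E] | i <- enum N].

(* The list, indexed by the actions e, of the static equivalents of [U,e]a
   at states satisfying the precondition of e. *)
Fixpoint push (fr : seq (seq (seq bool))) (pre : seq (bform P N)) a :
    seq (bform P N) :=
  match a with
  | BX p c => [seq BX p c | _ <- pre]
  | BNand a b => [seq BNand q.1 q.2 | q <- zip (push fr pre a) (push fr pre b)]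
  | BK i a =>
      let v := [seq BK i (BImp q.1 q.2) | q <- zip pre (push fr pre a)] in
      [seq guarded_conj (BK i a) (zip row v) | row <- nth [::] fr (enum_rank i)]
  end.

Lemma nth_frame_rows (E : finframe N) (i : N) :
  nth [::] (frame_rows E) (enum_rank i) =
  [seq [seq prel i x y | y <- enum E] | x <- enum E].
Proof.
by rewrite (nth_map i) ?nth_enum_rank // -cardE ltn_ord.
Qed.

(** At [BK] this is the reduction law: under pre(e), [U,e]K_i a amounts to the conjunction of K_i
    (pre(f) -> [U,f]a) over the actions f related to e, because the successors of (s,e) in the
    update are the pairs (t,f) with t related to s, f related to e and pre(f) true at t. The family
    [u] is the same for all models. *)
Lemma push_correct (E : finframe N) (pre : E -> bform P N) a :
  exists2 u : E -> bform P N,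
    push (frame_rows E) (map pre (enum E)) a = map u (enum E) &
    forall M (ok : M -> E -> bool), (forall t f, ok t f = bev (pre f) t) ->
    forall x : update ok, bev a x = bev (u (sval x).2) (sval x).1.
Proof.
elim: a => [p c|a [u uE uP] b [v vE vP]|i a [u uE uP]].
- exists (fun _ => BX p c) => [/=|M ok okE [[s e] se] //].
  by rewrite -map_comp.
- exists (fun e => BNand (u e) (v e)) => [/=|M ok okE x].
    by rewrite uE vE zip_map -map_comp.
  by rewrite /= (uP _ _ okE) (vP _ _ okE).
exists (fun e => guarded_conj (BK i a)
         [seq (prel i e f, BK i (BImp (pre f) (u f))) | f <- enum E]).
  rewrite /= uE nth_frame_rows -map_comp; apply: eq_map => e /=.
  by rewrite zip_map -map_comp zip_map.
move=> M ok okE [[s e] se]; rewrite bev_guarded_conj all_map bev_know.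
apply/asboolP/allP => [H f _|H [[t f] tf] [/= st ef]].
  apply/implyP => ef; rewrite bev_know; apply/asboolP => t st; rewrite bev_imp.
  apply/implyP => tf; rewrite -okE in tf.
  have := H (exist _ (t, f) tf : update ok).
  by rewrite (uP _ _ okE); apply.
have /implyP/(_ ef) := H f (mem_enum _ f).
by rewrite bev_know => /asboolP/(_ t st); rewrite bev_imp -okE tf (uP _ _ okE).
Qed.

(** The argument does not mention the type of actions: rows for the relations, a list for the
    preconditions, a rank for the action. The [data] slot makes room for what recursion on codes
    carries along with each translated precondition. *)
Definition tr_upd (z : seq (seq (seq bool)) *
    (seq (bform P N * bform P N * data) * (nat * (bform P N * bform P N)))) :=
  let pre := [seq x.1.1 | x <- z.2.1] in
  let k := z.2.2.1 in let b := z.2.2.2 in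
  (BImp (nth b.1 pre k) (nth b.1 (push z.1 pre b.1) k),
   BImp (nth b.1 pre k) (nth b.2 (push z.1 pre b.2) k)).

(* Static equivalents of "a is designated" and of "a has value 1". *)
Fixpoint tr (a : formula P N) : bform P N * bform P N :=
  match a with
  | Var p => (BOr (BX p true) (BX p false), BX p true)
  | Neg b => (BNot (tr b).2, BNot (tr b).1)
  | Bullet b => (BAnd (tr b).1 (BNot (tr b).2), BAnd (tr b).1 (BNot (tr b).2))
  | And b c => (BAnd (tr b).1 (tr c).1, BAnd (tr b).2 (tr c).2)
  | Know i b => (BK i (tr b).1, BK i (tr b).2)
  | Upd E pre e b =>
      tr_upd (frame_rows E, ([seq (tr (pre f), Nil) | f <- enum E],
              (enum_rank e : nat, tr b)))
  end.

(** Negation exchanges the two components, as 1 - v is designated iff v is not 1; a bullet takes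
    only the values 0 and 1, hence has equal components; an infimum is designated, or 1, iff all the
    values are. Where a precondition fails, the value 1 matches the vacuous implications. *)
Lemma tr_correct (a : formula P N) M (s : M) :
  bev (tr a).1 s = designated (eval a s) /\
  bev (tr a).2 s = tv_is true (eval a s).
Proof.
elim: a M s => [p|a IHa|a IHa|a IHa b IHb|i a IHa|E pre IHpre e a IHa] M s.
- by split=> //=; case: (val0 s p).
- have [/= -> ->] := IHa M s.
  by case: (eval a s).
- have [D T] := IHa M s.
  by rewrite [(tr _).1]/= [(tr _).2]/= bev_and bev_not D T /=; case: (eval a s).
- have [D T] := IHa M s; have [D' T'] := IHb M s.
  rewrite [(tr _).1]/= [(tr _).2]/= !bev_and D T D' T' /=.
  by case: (eval a s); case: (eval b s).
- rewrite /= /tinf; split.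
    case: (asboolP (exists2 t, krel i s t & eval a t = t0)) => [[t st t0E]|n0].
      by apply: asboolF => /(_ t st); rewrite (IHa M t).1 t0E.
    have -> : designated (if `[< exists2 t, krel i s t & eval a t = thalf >]
      then thalf else t1) = true by case: ifP.
    apply/asboolP => t st; rewrite (IHa M t).1.
    by case aE: (eval a t) => //; case: n0; exists t.
  case: (asboolP (exists2 t, krel i s t & eval a t = t0)) => [[t st t0E]|n0].
    by apply: asboolF => /(_ t st); rewrite (IHa M t).2 t0E.
  case: (asboolP (exists2 t, krel i s t & eval a t = thalf)) => [[t st t0E]|n1].
    by apply: asboolF => /(_ t st); rewrite (IHa M t).2 t0E.
  apply/asboolP => t st; rewrite (IHa M t).2.
  by case aE: (eval a t) => //; [case: n0 | case: n1]; exists t.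
pose pre' f := (tr (pre f)).1.
pose ok (t : M) f := designated (eval (pre f) t).
have okE t f : ok t f = bev (pre' f) t by rewrite (IHpre f M t).1.
have [u1 u1E u1P] := push_correct pre' (tr a).1.
have [u2 u2E u2P] := push_correct pre' (tr a).2.
have nthE d (v : E -> bform P N) : nth d (map v (enum E)) (enum_rank e) = v e.
  by rewrite (nth_map e) ?nth_enum_rank // -cardE ltn_ord.
have trE : tr (Upd pre e a) = (BImp (pre' e) (u1 e), BImp (pre' e) (u2 e)).
  rewrite [LHS]/= /tr_upd [LHS]/= -map_comp.
  by rewrite -[[seq _ | _ <- _]]/(map pre' (enum E)) u1E u2E !nthE.
have -> : eval (Upd pre e a) s =
  if insub (s, e) : option (upd_state ok) is Some x
  then eval a (x : update ok) else t1 by [].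
rewrite trE [bev _ _]bev_imp [X in _ /\ X = _]bev_imp -okE.
case: insubP => [x sok xE|/negbTE /= -> //].
have [{}u1P {}u2P] := (u1P _ _ okE x, u2P _ _ okE x).
move: u1P u2P; rewrite -[sval x]/(val x) xE /= => <- <-.
by rewrite (sok : ok s e = true) (IHa (update ok) x).1 (IHa (update ok) x).2.
Qed.
End Translation.

(** * Coherent sets of types *)

Definition sublists {T : Type} (s : seq T) : seq (seq T) :=
  foldr (fun x l => l ++ map (cons x) l) [:: [::]] s.

(** [p] may come from a classical predicate, so every set of elements of [s] is reached by the
    search. *)
Lemma filter_sublists (T : eqType) (p : pred T) s : filter p s \in sublists s.
Proof.
elim: s => //= x s IHs; rewrite mem_cat; case: (p x); last by rewrite IHs.
by rewrite (map_f (cons x) IHs) orbT.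
Qed.

Section Types.
Context {P : countType} {N : finType}.
Implicit Types (a phi : bform P N) (M : model P N).
(* A type is the list of the true formulas among the primes of a formula. *)
Implicit Types (x y : seq (bform P N)) (L : seq (seq (bform P N))).

(** Every list gets a valuation, even one with both atoms of [p], where [BX p true] takes
    precedence; so no consistency condition on atoms has to be imposed on types. *)
Definition type_val x (p : P) : tv :=
  if BX p true \in x then t1 else if BX p false \in x then thalf else t0.

Fixpoint holds x a : bool :=
  match a with
  | BX p c => tv_is c (type_val x p)
  | BNand a b => ~~ (holds x a && holds x b)
  | BK i a => BK i a \in x
  end.

Fixpoint primes a : seq (bform P N) :=
  match a with
  | BX p c => [:: BX p true; BX p false]
  | BNand a b => primes a ++ primes b
  | BK i a => BK i a :: primes a
  end.

Fixpoint vars a : seq P :=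
  match a with
  | BX p c => [:: p]
  | BNand a b => vars a ++ vars b
  | BK i a => vars a
  end.

Definition on_know (F : N -> bform P N -> bool) a : bool :=
  if a is BK i b then F i b else true.

Definition agree (ps : seq (bform P N)) (i : N) x y : bool :=
  all (on_know (fun j a => (i == j) ==> ((BK j a \in x) == (BK j a \in y)))) ps.

Definition coherent (ps : seq (bform P N)) L : bool :=
  all (fun x => all (on_know (fun i a =>
    (BK i a \in x) == all (fun y => agree ps i x y ==> holds y a) L)) ps) L.

Lemma agreeP ps i x y : reflect
  (forall a, BK i a \in ps -> (BK i a \in x) = (BK i a \in y)) (agree ps i x y).
Proof.
apply: (iffP allP) => [H a /H /=|H [p c|a b|j a] //= jps].
  by rewrite eqxx => /eqP.
by apply/implyP => /eqP ij; rewrite -ij in jps *; rewrite H.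
Qed.

Lemma agree_equiv ps L i :
  equivalence_rel
    (fun j k : 'I_(size L) => agree ps i (nth [::] L j) (nth [::] L k)).
Proof.
move=> j k l; split; first exact/agreeP.
move=> /agreeP jk; apply/agreeP/agreeP => H a aps.
  by rewrite -jk // H.
by rewrite jk // H.
Qed.

(** The states are positions in [L], which gives them the numbering used in the output. *)
Definition type_model phi L : finmodel P N :=
  @FinModel P N (FinFrame (@agree_equiv (primes phi) L))
    (fun j => [seq (p, type_val (nth [::] L j) p) | p <- vars phi]).

Lemma lookup_map (f : P -> tv) (s : seq P) p :
  p \in s -> lookup [seq (q, f q) | q <- s] p = f p.
Proof.
rewrite /lookup find_map => ps.
have pF : has (preim (fun q => (q, f q)) (fun z => z.1 == p)) s.
  by apply/hasP; exists p => /=.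
rewrite (nth_map p) -?has_find //=; congr f; apply/eqP.
exact: (nth_find p pF).
Qed.

(** At [BK i a], the successors of a state are the types agreeing with it on [i], and coherence says
    precisely that [BK i a] belongs to the type iff [a] holds at all of them. The inclusions keep
    the induction within the formulas that [coherent] and the tables cover. *)
Lemma truth_lemma phi L : coherent (primes phi) L ->
  forall a, {subset primes a <= primes phi} -> {subset vars a <= vars phi} ->
  forall s : kripke (type_model phi L), bev a s = holds (nth [::] L s) a.
Proof.
move=> /allP coh; elim=> [p c|a IHa b IHb|i a IHa] /= sp sv s.
- by rewrite lookup_map // sv ?mem_head.
- by rewrite IHa ?IHb // => q qa; rewrite ?sp ?sv // mem_cat qa ?orbT.
have sp' : {subset primes a <= primes phi}.
  by move=> q qa; rewrite sp // inE qa orbT.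
have Ls : nth [::] L s \in L by exact: mem_nth.
have /allP/(_ (BK i a) (sp _ (mem_head _ _)))/eqP -> := coh _ Ls.
apply/asboolP/allP => [H y /(nthP [::])[k ltk <-]|H t st].
  by apply/implyP => sk; have := H (Ordinal ltk) sk; rewrite IHa.
rewrite IHa //; have := H (nth [::] L t); rewrite mem_nth // => /(_ isT).
by move/implyP; apply.
Qed.

Definition type_of phi M (s : M) := [seq a <- primes phi | bev a s].

Lemma mem_type_of_know phi M (s : M) i a :
  BK i a \in primes phi -> (BK i a \in type_of phi s) = bev (BK i a) s.
Proof. by move=> ia; rewrite mem_filter ia andbT. Qed.


(** [primes] always lists both atoms of a variable, so the type fixes its value. *)
Lemma holds_type_of phi M (s : M) a :
  {subset primes a <= primes phi} -> holds (type_of phi s) a = bev a s.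
Proof.
elim: a => [p c|a IHa b IHb|i a IHa] sp.
- rewrite /= /type_val !mem_filter !sp ?inE ?eqxx ?orbT //= !andbT.
  by case: (val0 s p); case: c {sp}.
- by rewrite /= IHa ?IHb // => q qa; rewrite sp // mem_cat qa ?orbT.
- by rewrite [LHS]/= mem_type_of_know // sp ?mem_head.
Qed.

Lemma primes_know phi i a :
  BK i a \in primes phi -> {subset primes a <= primes phi}.
Proof.
elim: phi => [p c|b IHb c IHc|j b IHb] /=.
- by rewrite !inE => /orP[] /eqP.
- rewrite mem_cat => /orP[/IHb|/IHc] H q /H qb; by rewrite mem_cat qb ?orbT.
- by rewrite inE => /predU1P[[_ ->] q qb|/IHb H q /H qb]; rewrite inE qb orbT.
Qed.

(** The S5 laws enter here. If [BK i a] holds at a state, it holds wherever the type agrees, and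
    reflexivity yields [a] there. Conversely, states related by [krel i] satisfy the same
    K_i-formulas, by symmetry and transitivity, so their types agree. *)
Lemma coherent_types phi M L :
  (forall x, x \in L <-> exists s : M, x = type_of phi s) ->
  coherent (primes phi) L.
Proof.
move=> LE; apply/allP => _ /LE[s ->]; apply/allP => -[p c|a b|i a] //= ia.
have [Mr Ms Mt] := krel_equiv M i.
rewrite mem_type_of_know //; apply/eqP; apply/asboolP/allP.
  move=> H _ /LE[t ->]; apply/implyP => /agreeP/(_ a ia).
  rewrite !mem_type_of_know // holds_type_of; last exact: primes_know ia.
  rewrite !bev_know asboolT // => /esym/asboolP; apply; exact: Mr.
move=> H t st; have tL : type_of phi t \in L by apply/LE; exists t.
have := H _ tL; rewrite holds_type_of; last exact: primes_know ia.
move/implyP; apply; apply/agreeP => b ib.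
rewrite !mem_type_of_know // !bev_know.
apply: asbool_equiv_eq; split=> K u.
  by move=> tu; apply: K; apply: Mt st tu.
by move=> su; apply: K; apply: Mt su; apply: Ms.
Qed.

Definition witnesses phi : seq (seq (seq (bform P N))) :=
  [seq L <- sublists (sublists (primes phi)) |
    coherent (primes phi) L && has (fun x => holds x phi) L].

Definition sat_answer phi : bool := ~~ nilp (witnesses phi).

(** An unsatisfiable formula is refuted at every state; the default, a single empty type, supplies a
    model with one state for that case. *)
Definition types_answer phi : seq (seq (bform P N)) :=
  head [:: [::]] (witnesses phi).

Definition index_answer phi : nat :=
  if sat_answer phi then find (fun x => holds x phi) (types_answer phi) else 0.

Lemma witness_answer phi : sat_answer phi ->
  coherent (primes phi) (types_answer phi) /\
  has (fun x => holds x phi) (types_answer phi).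
Proof.
rewrite /sat_answer /types_answer; case E: (witnesses phi) => [//|L l] _.
have: L \in witnesses phi by rewrite E mem_head.
by rewrite mem_filter => /andP[/andP[]].
Qed.

Lemma index_answer_lt phi : index_answer phi < size (types_answer phi).
Proof.
rewrite /index_answer; case: ifP => [/witness_answer[_]|].
  by rewrite has_find.
by rewrite /sat_answer /types_answer; case: (witnesses phi).
Qed.

Lemma sat_answer_sound phi (s : kripke (type_model phi (types_answer phi))) :
  sat_answer phi -> s = index_answer phi :> nat -> bev phi s.
Proof.
move=> sat sE; have [coh ex] := witness_answer sat.
by rewrite (truth_lemma coh) // sE /index_answer sat; exact: (nth_find [::] ex).
Qed.

Lemma sat_answer_complete phi M (s : M) : bev phi s -> sat_answer phi.
Proof.
move=> phis.
(* The types realised in [M] are selected classically; [M] may be infinite, but the selection is one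
   of the finitely many candidates. *)
pose L := [seq x <- sublists (primes phi) |
  `[< exists s : M, x = type_of phi s >]].
have LE x : x \in L <-> exists s : M, x = type_of phi s.
  rewrite mem_filter; split=> [/andP[/asboolP]|[t ->]] //.
  by rewrite filter_sublists andbT; apply/asboolP; exists t.
have: L \in witnesses phi.
  rewrite mem_filter filter_sublists andbT (coherent_types LE) /=.
  apply/hasP; exists (type_of phi s); last by rewrite holds_type_of.
  by apply/LE; exists s.
by rewrite /sat_answer; case: (witnesses phi).
Qed.
End Types.

(** * Computability of the decision procedure *)

Section Procedure.
Context {P : countType} {N : finType}.

Instance enc_var_inst : Enc P := fun p => enc_nat (pickle p).
Instance enc_agent_inst : Enc N := @enc_fin N.

(** After the tag stands a plain pair, so that the components are the two halves of the tail, for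
    which recursion on trees provides results. *)
Fixpoint enc_bform (a : bform P N) : data :=
  match a with
  | BX p c => Cons (enc_nat 0) (Cons (enc p) (enc c))
  | BNand a b => Cons (enc_nat 1) (Cons (enc_bform a) (enc_bform b))
  | BK i a => Cons (enc_nat 2) (Cons (enc i) (enc_bform a))
  end.
Instance enc_bform_inst : Enc (bform P N) := enc_bform.
Instance enc_formula_inst : Enc (formula P N) := @enc_formula P N.

Lemma enc_nat_inj : injective enc_nat.
Proof. by elim=> [|m IHm] [|n] // [/IHm ->]. Qed.

Lemma enc_bool_inj : injective (enc : bool -> data).
Proof. by move=> [] []. Qed.

Lemma enc_agent_inj : injective (enc : N -> data).
Proof. by move=> i j /enc_nat_inj/ord_inj/enum_rank_inj. Qed.

Lemma enc_bform_inj : injective (enc : bform P N -> data).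
Proof.
elim=> [p c|a IHa b IHb|i a IHa] [q d|a' b'|j a'] //=.
- case=> /enc_nat_inj/(pcan_inj pickleK) ->.
  by move/(@enc_bool_inj c d) ->.
- by case=> /IHa -> /IHb ->.
- by case=> /enc_agent_inj -> /IHa ->.
Qed.

(** * Recursion on codes of static formulas *)

Section Fold.
Context {G A : Type} {EG : Enc G} {EA : Enc A}.

(** [fK] receives the subformula besides its result, since [primes], [holds] and [push] need
    [BK i a] itself. *)
Fixpoint bfold (fX : P -> bool -> A) (fN : A -> A -> A)
    (fK : N -> bform P N -> A -> A) (a : bform P N) : A :=
  match a with
  | BX p c => fX p c
  | BNand a b => fN (bfold fX fN fK a) (bfold fX fN fK b)
  | BK i a => fK i a (bfold fX fN fK a)
  end.

Lemma computable_bfold (fX : G -> P -> bool -> A) (fN : G -> A -> A -> A)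
    (fK : G -> N -> bform P N -> A -> A) (a : G -> bform P N) :
  computable (fun z : G * (P * bool) => fX z.1 z.2.1 z.2.2) ->
  computable (fun z : G * (A * A) => fN z.1 z.2.1 z.2.2) ->
  computable (fun z : G * (N * (bform P N * A)) =>
    fK z.1 z.2.1 z.2.2.1 z.2.2.2) ->
  computable a ->
  computable (fun x => bfold (fX x) (fN x) (fK x) (a x)).
Proof.
move=> [X Xc XE] [D Dc DE] [K Kc KE] [a' ac aE].
(* z = (p, (d, (ra, rb))), where d encodes a formula and ra, rb are the
   results for the two halves of [tl d]. *)
pose g z := if hd (hd (tl z)) is Cons _ _ then
    if tl (hd (hd (tl z))) is Cons _ _ then
      K (Cons (hd z) (Cons (hd (tl (hd (tl z))))
           (Cons (tl (tl (hd (tl z)))) (tl (tl (tl z))))))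
    else D (Cons (hd z) (tl (tl z)))
  else X (Cons (hd z) (tl (hd (tl z)))).
(* Recursion reaches only the two halves of a tree, but the results are needed
   one level below: the result for each tree carries those for its halves. *)
pose f z := if tl z is Cons _ _ then
    Cons (g (Cons (hd z) (Cons (hd (tl z)) (tl (tl (tl (tl z)))))))
         (Cons (hd (hd (tl (tl z)))) (hd (tl (tl (tl z)))))
  else Nil.
pose k z := Cons (hd z) (hd z).
have gc : dcomp g.
  by repeat first [exact: dcomp_id | apply: dcomp_if | apply: dcomp_cons
                  | apply: dcomp_hd | apply: dcomp_tl | apply: (dcomp_comp Xc)
                  | apply: (dcomp_comp Dc) | apply: (dcomp_comp Kc)].
have fc : dcomp f.
  by repeat first [apply: (dcomp_comp gc) | exact: dcomp_id | exact: dcomp_const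
                  | apply: dcomp_if | apply: dcomp_cons | apply: dcomp_hd
                  | apply: dcomp_tl].
have kc : dcomp k by apply: dcomp_cons; apply: dcomp_hd dcomp_id.
exists (fun x => hd (drec f k x (a' x))).
  apply: dcomp_hd.
  apply: (dcomp_comp (dcomp_drec fc kc) (g := fun x => Cons x (a' x))).
  by apply: dcomp_cons => //; apply: dcomp_id.
move=> x; rewrite aE; set p := enc x.
have step t u v : hd (drec f k p (Cons t (Cons u v))) =
    g (Cons p (Cons (Cons t (Cons u v))
                 (Cons (hd (drec f k p u)) (hd (drec f k p v))))) by [].
elim: (a x) => [q c|b IHb c IHc|i b IHb].
- by rewrite [LHS]step -(XE (x, (q, c))).
- by rewrite [LHS]step IHb IHc -(DE (x, (_, _))).
- by rewrite [LHS]step IHb -(KE (x, (i, (b, _)))).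
Qed.
End Fold.

Lemma computable_BX : computable (fun z : P * bool => BX z.1 z.2 : bform P N).
Proof.
exists (fun z => Cons (enc_nat 0) z) => [|[] //].
exact: dcomp_cons (dcomp_const _) dcomp_id.
Qed.

Lemma computable_BNand :
  computable (fun z : bform P N * bform P N => BNand z.1 z.2).
Proof.
exists (fun z => Cons (enc_nat 1) z) => [|[] //].
exact: dcomp_cons (dcomp_const _) dcomp_id.
Qed.

Lemma computable_BK : computable (fun z : N * bform P N => BK z.1 z.2).
Proof.
exists (fun z => Cons (enc_nat 2) z) => [|[] //].
exact: dcomp_cons (dcomp_const _) dcomp_id.
Qed.

Lemma computable_rank : computable (fun i : N => enum_rank i : nat).
Proof. by exists id; first exact: dcomp_id. Qed.

Section Operations.
Context {G : Type} {EG : Enc G}.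

Lemma computable_bx (p : G -> P) (c : G -> bool) :
  computable p -> computable c ->
  computable (fun x => BX (p x) (c x) : bform P N).
Proof.
move=> c1 c2.
exact: (computable_comp computable_BX (computable_pair c1 c2)).
Qed.

Lemma computable_bnand (a b : G -> bform P N) :
  computable a -> computable b -> computable (fun x => BNand (a x) (b x)).
Proof.
move=> c1 c2.
exact: (computable_comp computable_BNand (computable_pair c1 c2)).
Qed.

Lemma computable_bk (i : G -> N) (a : G -> bform P N) :
  computable i -> computable a -> computable (fun x => BK (i x) (a x)).
Proof.
move=> c1 c2.
exact: (computable_comp computable_BK (computable_pair c1 c2)).
Qed.

Lemma computable_enum_rank (i : G -> N) :
  computable i -> computable (fun x => enum_rank (i x) : nat).
Proof. exact: computable_comp computable_rank. Qed.

Lemma computable_in (a : G -> bform P N) (x : G -> seq (bform P N)) :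
  computable a -> computable x -> computable (fun g => a g \in x g).
Proof. exact: computable_mem enc_bform_inj. Qed.

Lemma computable_eqb (b c : G -> bool) :
  computable b -> computable c -> computable (fun x => b x == c x).
Proof. exact: computable_eq enc_bool_inj. Qed.

Lemma computable_eq_agent (i j : G -> N) :
  computable i -> computable j -> computable (fun x => i x == j x).
Proof. exact: computable_eq enc_agent_inj. Qed.
End Operations.

(** A hook in [computability], rebound below once the compound operations have their own lemmas. *)
Ltac computable_named := fail.

Ltac computability := cbv beta; repeat (first
  [ assumption | computable_named
  | match goal with H : computable ?f |- _ =>
      refine (@computable_comp _ _ _ _ _ _ _ _ H _)
    end
  | exact: computable_id | exact: computable_const
  | simple apply computable_pair | simple apply computable_fst
  | simple apply computable_snd | simple apply computable_if
  | simple apply computable_and | simple apply computable_not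
  | simple apply computable_imp | apply computable_eqb
  | apply computable_eq_agent
  | apply computable_in | simple apply computable_cons
  | simple apply computable_cat | simple apply computable_head
  | simple apply computable_nth | simple apply computable_nilp
  | simple apply computable_zip
  | apply computable_map | apply computable_filter
  | apply computable_all | apply computable_has
  | apply computable_find | apply computable_foldr
  | simple apply computable_bx | simple apply computable_bnand
  | simple apply computable_bk | simple apply computable_enum_rank
  | apply computable_bfold ]; cbv beta).

Section Procedures.
Context {G : Type} {EG : Enc G}.

Lemma computable_sublists (T : Type) (ET : Enc T) (s : G -> seq T) :
  computable s -> computable (fun g => sublists (s g)).
Proof. by move=> sc; rewrite /sublists; computability. Qed.

Lemma computable_type_val (x : G -> seq (bform P N)) (p : G -> P) :
  computable x -> computable p -> computable (fun g => type_val (x g) (p g)).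
Proof. by move=> xc pc; rewrite /type_val; computability. Qed.

Lemma computable_holds (x : G -> seq (bform P N)) (a : G -> bform P N) :
  computable x -> computable a -> computable (fun g => holds (x g) (a g)).
Proof.
move=> xc ac.
have E g : bfold
    (fun p c => if BX p true \in x g then c else
                if BX p false \in x g then ~~ c else false)
    (fun u v => ~~ (u && v)) (fun i a _ => BK i a \in x g) (a g) =
    holds (x g) (a g).
  elim: (a g) => [p c|b IHb c IHc|i b _] //=; last by rewrite IHb IHc.
  by rewrite /type_val; do 2 (case: ifP => //).
apply: (computable_ext E).
by computability.
Qed.

Lemma computable_primes (a : G -> bform P N) :
  computable a -> computable (fun g => primes (a g)).
Proof.
move=> ac; have E g : bfold (fun p _ => [:: BX p true; BX p false]) cat
    (fun i b s => BK i b :: s) (a g) = primes (a g).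
  by elim: (a g) => [p c|b IHb c IHc|i b IHb] //=; rewrite ?IHb ?IHc.
by apply: (computable_ext E); computability.
Qed.

Lemma computable_vars (a : G -> bform P N) :
  computable a -> computable (fun g => vars (a g)).
Proof.
move=> ac; have E g : bfold (fun p _ => [:: p]) cat (fun _ _ s => s) (a g) =
    vars (a g).
  by elim: (a g) => [p c|b IHb c IHc|i b IHb] //=; rewrite ?IHb ?IHc.
by apply: (computable_ext E); computability.
Qed.

Lemma computable_on_know (F : G -> N -> bform P N -> bool)
    (a : G -> bform P N) :
  computable (fun z : G * (N * bform P N) => F z.1 z.2.1 z.2.2) ->
  computable a -> computable (fun g => on_know (F g) (a g)).
Proof.
move=> Fc ac; have E g : bfold (fun _ _ => true) (fun _ _ => true)
    (fun i b _ => F g i b) (a g) = on_know (F g) (a g) by case: (a g).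
apply: (computable_ext E); apply: computable_bfold => //; try by computability.
apply: (computable_comp Fc (g := fun z => (z.1, (z.2.1, z.2.2.1)))).
by computability.
Qed.

Lemma computable_guarded_conj (a : G -> bform P N)
    (s : G -> seq (bool * bform P N)) :
  computable a -> computable s ->
  computable (fun g => guarded_conj (a g) (s g)).
Proof.
by move=> ac sc; rewrite /guarded_conj /BAnd /BImp /BNot; computability.
Qed.
End Procedures.

Ltac computable_named ::= first
  [ simple apply computable_sublists | simple apply computable_type_val
  | simple apply computable_holds | simple apply computable_primes
  | simple apply computable_vars | apply computable_on_know
  | simple apply computable_guarded_conj ].

Section Search.
Context {G : Type} {EG : Enc G}.

Lemma computable_push (fr : G -> seq (seq (seq bool)))
    (pre : G -> seq (bform P N)) (a : G -> bform P N) :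
  computable fr -> computable pre -> computable a ->
  computable (fun g => push (fr g) (pre g) (a g)).
Proof.
move=> frc prec ac; have E g : bfold (fun p c => [seq BX p c | _ <- pre g])
    (fun u v => [seq BNand q.1 q.2 | q <- zip u v])
    (fun i b u => [seq guarded_conj (BK i b)
       (zip row [seq BK i (BImp q.1 q.2) | q <- zip (pre g) u])
       | row <- nth [::] (fr g) (enum_rank i)]) (a g) =
    push (fr g) (pre g) (a g).
  by elim: (a g) => [p c|b IHb c IHc|i b IHb] //=; rewrite ?IHb ?IHc.
by apply: (computable_ext E); rewrite /BImp /BNot; computability.
Qed.

Lemma computable_agree (ps : G -> seq (bform P N)) (i : G -> N)
    (x y : G -> seq (bform P N)) :
  computable ps -> computable i -> computable x -> computable y ->
  computable (fun g => agree (ps g) (i g) (x g) (y g)).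
Proof. by move=> psc ic xc yc; rewrite /agree; computability. Qed.

Lemma computable_coherent (ps : G -> seq (bform P N))
    (L : G -> seq (seq (bform P N))) :
  computable ps -> computable L -> computable (fun g => coherent (ps g) (L g)).
Proof.
move=> psc Lc; rewrite /coherent.
by do ?[simple apply computable_agree | progress computability].
Qed.

Lemma computable_witnesses (a : G -> bform P N) :
  computable a -> computable (fun g => witnesses (a g)).
Proof.
move=> ac; rewrite /witnesses.
by do ?[simple apply computable_coherent | progress computability].
Qed.

Lemma computable_sat_answer (a : G -> bform P N) :
  computable a -> computable (fun g => sat_answer (a g)).
Proof.
move=> ac; apply: computable_not; apply: computable_nilp.
exact: computable_witnesses.
Qed.

Lemma computable_types_answer (a : G -> bform P N) :
  computable a -> computable (fun g => types_answer (a g)).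
Proof.
move=> ac; apply: computable_head; first exact: computable_const.
exact: computable_witnesses.
Qed.

Lemma computable_index_answer (a : G -> bform P N) :
  computable a -> computable (fun g => index_answer (a g)).
Proof.
move=> ac; apply: computable_if; first exact: computable_sat_answer.
  apply: computable_find; last exact: computable_types_answer.
  by computability.
exact: computable_const.
Qed.
End Search.

(** The tuple has the shape of the tree built by [enc_answer]; the final [Nil] ends its list of
    three. *)
Definition answer (a : bform P N) :=
  let L := types_answer a in
  (sat_answer a,
   (([seq [seq [seq agree (primes a) i x y | y <- L] | x <- L] | i <- enum N],
     [seq [seq (p, type_val x p) | p <- vars a] | x <- L]),
    (index_answer a, Nil))).

Lemma computable_answer : computable answer.
Proof.
rewrite /answer.
by do ?[simple apply computable_sat_answer
  | simple apply computable_types_answer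
  | simple apply computable_index_answer | simple apply computable_agree
  | progress computability].
Qed.

(** Passes from the positions, over which the model is encoded, to the types, over which [answer]
    computes. *)
Lemma map_enum_nth T (x0 : T) (s : seq T) S (f : T -> S) :
  map (fun i : 'I_(size s) => f (nth x0 s i)) (enum 'I_(size s)) = map f s.
Proof.
rewrite -[in RHS](mkseq_nth x0 s) /mkseq -val_enum_ord -!map_comp.
exact: eq_map.
Qed.

Lemma enc_answer_eq (a : bform P N)
    (s : type_model a (types_answer a)) :
  s = index_answer a :> nat -> enc_answer (sat_answer a) s = enc (answer a).
Proof.
move=> sE; rewrite /enc_answer /enc_model /enc_frame /enc_fin enum_rank_ord /=.
rewrite sE.
congr (Cons _ (Cons (Cons (enc_seq _) (enc_seq _)) _)).
  rewrite [(answer a).2.1.1]/= -[RHS]map_comp; apply: eq_map => i /=.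
  congr enc_seq.
  rewrite (map_enum_nth [::] _ (fun x => enc_seq (map
    (fun j : 'I_(size (types_answer a)) =>
       enc_bool (agree (primes a) i x (nth [::] (types_answer a) j)))
    (enum 'I_(size (types_answer a)))))).
  rewrite -[RHS]map_comp; apply: eq_map => x /=; congr enc_seq.
  rewrite (map_enum_nth [::] _ (fun y => enc_bool (agree (primes a) i x y))).
  by rewrite -[RHS]map_comp.
rewrite (map_enum_nth [::] _ (fun x => enc_seq [seq Cons (enc_nat (pickle z.1))
  (enc_tv z.2) | z <- [seq (p, type_val x p) | p <- vars a]])).
by rewrite -map_comp.
Qed.

(** Recursion on trees read as nested lists. A nonempty list is mapped to its result followed by the
    images of all its members, so that [g] can reach results at any depth; the preconditions of an
    update sit inside a list of their own. *)
Lemma dcomp_rose (g : data -> data) : dcomp g -> exists h, [/\ dcomp h,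
  forall ds, tl (h (enc_seq ds)) = enc_seq (map h ds) &
  forall x ds, h (enc_seq (x :: ds)) =
    Cons (g (Cons (enc_seq (x :: ds)) (enc_seq (map h ds))))
         (enc_seq (map h (x :: ds)))].
Proof.
move=> gc.
pose f z := if tl z is Cons _ _ then
    Cons (g (Cons (hd (tl z)) (tl (tl (tl (tl z))))))
         (Cons (hd (tl (tl z))) (tl (tl (tl (tl z)))))
  else Nil.
pose k z := Cons (hd z) (hd z).
have fc : dcomp f.
  by repeat first [apply: (dcomp_comp gc) | exact: dcomp_id | exact: dcomp_const
                  | apply: dcomp_if | apply: dcomp_cons | apply: dcomp_hd
                  | apply: dcomp_tl].
have kc : dcomp k by apply: dcomp_cons; apply: dcomp_hd dcomp_id.
exists (drec f k Nil).
have tlE ds : tl (drec f k Nil (enc_seq ds)) = enc_seq (map (drec f k Nil) ds).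
  by elim: ds => //= x ds IHds; rewrite /f /= IHds.
split=> //; last by move=> x ds; rewrite /= {1}/f /= tlE.
apply: (dcomp_comp (dcomp_drec fc kc) (g := Cons Nil)).
by apply: dcomp_cons; [apply: dcomp_const | apply: dcomp_id].
Qed.

Lemma computable_tr_upd : computable (@tr_upd P N).
Proof.
rewrite /tr_upd /BImp /BNot.
by do ?[simple apply computable_push | progress computability].
Qed.

Lemma enc_frame_rows (E : finframe N) : enc (frame_rows E) = enc_frame E.
Proof.
rewrite -[LHS]/(enc_seq (map enc (frame_rows E))) -map_comp; congr enc_seq.
apply: eq_map => i; rewrite -[LHS]/(enc_seq (map enc _)) -map_comp.
congr enc_seq; apply: eq_map => x.
by rewrite -[LHS]/(enc_seq (map enc _)) -map_comp.
Qed.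

Lemma computable_tr : computable (@tr P N).
Proof.
have [fV cV EV] : computable (fun p : P =>
  (BOr (BX p true) (BX p false), BX p true : bform P N)).
  by rewrite /BOr /BNot; computability.
have [fN cN EN] : computable (fun t : bform P N * bform P N =>
  (BNot t.2, BNot t.1)).
  by rewrite /BNot; computability.
have [fB cB EB] : computable (fun t : bform P N * bform P N =>
  (BAnd t.1 (BNot t.2), BAnd t.1 (BNot t.2))).
  by rewrite /BAnd /BNot; computability.
have [fA cA EA] : computable (fun
  t : bform P N * bform P N * (bform P N * bform P N) =>
  (BAnd t.1.1 t.2.1, BAnd t.1.2 t.2.2)).
  by rewrite /BAnd /BNot; computability.
have [fK cK EK] : computable (fun t : N * (bform P N * bform P N) =>
  (BK t.1 t.2.1, BK t.1 t.2.2)).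
  by computability.
have [fU cU EU] := computable_tr_upd.
(* z consists of the code of a formula and the results for the components
   after its tag. *)
pose g z :=
  if hd (hd z) is Cons _ _ then if tl (hd (hd z)) is Cons _ _ then
  if tl (tl (hd (hd z))) is Cons _ _ then
  if tl (tl (tl (hd (hd z)))) is Cons _ _ then
  if tl (tl (tl (tl (hd (hd z))))) is Cons _ _ then
    fU (Cons (hd (tl (hd z))) (Cons (tl (hd (tl (tl z))))
       (Cons (hd (tl (tl (tl (hd z))))) (hd (hd (tl (tl (tl (tl z)))))))))
  else fK (Cons (hd (tl (hd z))) (hd (hd (tl (tl z)))))
  else fA (Cons (hd (hd (tl z))) (hd (hd (tl (tl z)))))
  else fB (hd (hd (tl z)))
  else fN (hd (hd (tl z)))
  else fV (hd (tl (hd z))).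
have gc : dcomp g.
  by repeat first [exact: dcomp_id | apply: dcomp_if | apply: dcomp_cons
    | apply: dcomp_hd | apply: dcomp_tl | apply: (dcomp_comp cU)
    | apply: (dcomp_comp cK) | apply: (dcomp_comp cA) | apply: (dcomp_comp cB)
    | apply: (dcomp_comp cN) | apply: (dcomp_comp cV)].
have [h [hc tlE hE]] := dcomp_rose gc.
exists (fun d => hd (h d)); first exact: dcomp_hd.
have hdE x ds : hd (h (enc_seq (x :: ds))) =
  g (Cons (enc_seq (x :: ds)) (enc_seq (map h ds))) by rewrite hE.
elim=> [p|a IHa|a IHa|a IHa b IHb|i a IHa|E pre IHpre e a IHa].
- by rewrite [LHS]hdE /g /= EV.
- by rewrite [LHS]hdE /g /= -(EN (tr a)) -IHa.
- by rewrite [LHS]hdE /g /= -(EB (tr a)) -IHa.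
- rewrite [LHS]hdE /g /= (IHa : hd (h (enc_formula a)) = _).
  by rewrite (IHb : hd (h (enc_formula b)) = _) -(EA (tr a, tr b)).
- rewrite [LHS]hdE /g /= (IHa : hd (h (enc_formula a)) = _).
  by rewrite -(EK (i, tr a)).
(* On the code of a precondition [h] yields the translation followed by the images of the members of
   that code; these fill the [data] slot. *)
pose X f := (tr (pre f), tl (h (enc_formula (pre f)))).
have -> : tr (Upd pre e a) = tr_upd (frame_rows E,
    ([seq X f | f <- enum E], (enum_rank e : nat, tr a))).
  by rewrite /= /tr_upd /= -!map_comp.
rewrite [LHS]hdE -EU /g [LHS]/= tlE.
congr fU; congr (Cons _ (Cons _ (Cons _ _))).
- by rewrite -enc_frame_rows.
- rewrite -[RHS]/(enc_seq (map enc _)) -!map_comp; congr enc_seq.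
  apply: eq_map => f; rewrite -[LHS]/(h (enc_formula (pre f))).
  rewrite -[RHS]/(Cons (enc (tr (pre f))) (tl (h (enc_formula (pre f))))).
  rewrite -IHpre -[enc (pre f)]/(enc_formula (pre f)).
  (* The code of a formula is never the empty list, so [hE] exposes the result. *)
  have [x [ds ->]] : exists x ds, enc_formula (pre f) = enc_seq (x :: ds).
    by case: (pre f) => *; do 2 eexists.
  by rewrite hE.
- exact: IHa.
Qed.

End Procedure.

(** * Assembly of the procedure: translation, search, output of a model *)

Theorem theorem45 (P : countType) (N : finType) :
  exists pr : program,
    forall a : formula P N,
      exists (b : bool) (M : finmodel P N) (s : M),
        run pr (enc_formula a) (enc_answer b s) /\
        (b = true <-> satisfiable a) /\
        (if b then designated (@eval P N a (kripke M) s) : Prop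
         else @eval P N a (kripke M) s = t0).
Proof.
have [f [pr prE] fE] :=
  computable_comp (@computable_answer P N) (computable_fst computable_tr).
exists pr => a; pose phi := (tr a).1.
pose s : type_model phi (types_answer phi) := Ordinal (index_answer_lt phi).
have phiE (M : model P N) (t : M) : bev phi t = designated (eval a t).
  by have [] := tr_correct a t.
exists (sat_answer phi), (type_model phi (types_answer phi)), s.
have sound : sat_answer phi -> designated (@eval P N a (kripke _) s).
  by move=> sat; rewrite -phiE; apply: sat_answer_sound.
have complete (M : model P N) (t : M) : designated (eval a t) -> sat_answer phi.
  by rewrite -phiE; apply: sat_answer_complete.
split; last split.
- by rewrite (enc_answer_eq (s := s)) // -fE; apply: prE.
- split=> [/sound sat|[M [t /complete]] //].
  by exists (kripke (type_model phi (types_answer phi))), s.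
case unsat: (sat_answer phi); first exact: sound.
(* Without a witness, completeness excludes a designated value at every state, in particular at the
   default one. *)
have := complete (kripke (type_model phi (types_answer phi))) s.
by rewrite unsat; case: (eval a _) => // /(_ isT).
Qed.
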